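(* Let $R$ be a commutative ring, $S$ a multiplicative set in $R$, and $I$ a decomposable ideal of $R$ with a given primary decomposition $I=\bigcap_{i=1}^n Q_i$. Suppose that for each $i$ it can be decided whether $Q_i\cap S=\emptyset$. For each $i\in\{1,\ldots,n\}$ set $\tilde Q_i:=Q_i$ if $Q_i\cap S=\emptyset$, and $\tilde Q_i:=R$ otherwise. Then the output $\tilde I:=\bigcap_{i=1}^n\tilde Q_i$ is the $S$-closure $I^S$ of $I$, i.e. $I^S=\bigcap_{i=1}^n\tilde Q_i$.
   Context: A multiplicative set $S\subseteq R$ satisfies $1\in S$, $0\notin S$ and is closed under multiplication. An ideal is decomposable if it is an intersection of finitely many primary ideals. For an ideal $I$, the $S$-closure is $I^S:=\rho^{-1}(S^{-1}I)$ with $\rho:R\to S^{-1}R$ the localization map (equivalently, $I^S=\{a\in R\mid\exists\, s\in S:\ sa\in I\}$). *)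

(* Defs.v *)
From HB Require Import structures.
From mathcomp Require Import all_boot all_algebra.
From mathcomp Require Import all_classical.
From mathcomp Require Import ring.

Set Implicit Arguments.
Unset Strict Implicit.
Unset Printing Implicit Defensive.

Import GRing.Theory.
Local Open Scope ring_scope.
Local Open Scope classical_set_scope.
Local Open Scope quotient_scope.

(* Ideals are arbitrary (not necessarily decidable) subsets of R, and they may
   be improper; this differs from idealr_closed of ring_quotient, which only
   describes proper ideals given by boolean predicates. *)
Definition is_ideal (R : comPzRingType) (I : set R) : Prop :=
  [/\ I 0, (forall a b, I a -> I b -> I (a + b))
    & (forall r a, I a -> I (r * a))].

Definition is_primary (R : comPzRingType) (Q : set R) : Prop :=
  [/\ is_ideal Q, Q <> [set: R]
    & forall a b, Q (a * b) -> Q a \/ exists n : nat, Q (b ^+ n.+1)].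

(* For n = 0 the intersection is the whole ring. *)
Definition primary_decomposition (R : comPzRingType) (n : nat)
    (I : set R) (Q : 'I_n -> set R) : Prop :=
  (forall i, is_primary (Q i)) /\ I = \bigcap_i Q i.

Record mulset (R : comPzRingType) := Mulset {
  mulset_set :> set R;
  mulset1 : mulset_set 1;
  mulset0 : ~ mulset_set 0;
  mulsetM : forall s t, mulset_set s -> mulset_set t -> mulset_set (s * t)
}.

Section Localization.
Variables (R : comPzRingType) (S : mulset R).
Implicit Types (a b c : R) (s t u : set_type S).

Definition den s : R := \val s.

Lemma denP s : mulset_set S (den s). Proof. exact/set_mem/(valP s). Qed.

Definition den1 : set_type S := SigSub (mem_set (mulset1 S)).

Definition denM s t : set_type S :=
  SigSub (mem_set (mulsetM (denP s) (denP t))).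

Lemma den1E : den den1 = 1. Proof. by []. Qed.

Lemma denME s t : den (denM s t) = den s * den t. Proof. by []. Qed.

(* a / s and b / t are identified when u (t a - s b) = 0 for some u in S; the
   factor u is needed since S may contain zero divisors. *)
Definition loc_eq : rel (R * set_type S) := fun x y =>
  `[< exists2 u, mulset_set S u & u * (den y.2 * x.1) = u * (den x.2 * y.1) >].

Lemma loc_eq_refl : reflexive loc_eq.
Proof. by move=> x; apply/asboolP; exists 1 => //; exact: mulset1. Qed.

Lemma loc_eq_sym : symmetric loc_eq.
Proof.
by move=> x y; apply/asboolP/asboolP => -[u Su e]; exists u.
Qed.

Lemma loc_eq_trans : transitive loc_eq.
Proof.
move=> [b t] [a s] [c r] /asboolP[/= u Su e] /asboolP[/= v Sv f].
apply/asboolP; exists (u * v * den t) => /=.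
  exact: mulsetM (mulsetM Su Sv) (denP t).
have -> : u * v * den t * (den r * a) = v * den r * (u * (den t * a)) by ring.
have -> : u * v * den t * (den s * c) = u * den s * (v * (den t * c)) by ring.
by rewrite e -f; ring.
Qed.

Canonical loc_eq_equiv := EquivRel loc_eq loc_eq_refl loc_eq_sym loc_eq_trans.

Definition loc := {eq_quot loc_eq}.
HB.instance Definition _ : EqQuotient _ loc_eq loc := EqQuotient.on loc.
HB.instance Definition _ := Choice.on loc.

Definition loc_frac a s : loc := \pi_loc (a, s).

Lemma loc_frac_eq a s b t : loc_frac a s = loc_frac b t <->
  exists2 u, mulset_set S u & u * (den t * a) = u * (den s * b).
Proof.
split=> [/eqP|h]; first by rewrite /loc_frac eqmodE => /asboolP.
by apply/eqP; rewrite /loc_frac eqmodE; apply/asboolP.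
Qed.

Lemma loc_fracP (x : loc) : exists a s, x = loc_frac a s.
Proof.
exists (repr x).1, (repr x).2; rewrite /loc_frac -surjective_pairing.
by rewrite reprK.
Qed.

Definition loc_num (x : loc) : R := (repr x).1.
Definition loc_den (x : loc) : set_type S := (repr x).2.

Lemma loc_numP a s : exists2 u, mulset_set S u &
  u * (den (loc_den (loc_frac a s)) * a) = u * (den s * loc_num (loc_frac a s)).
Proof.
apply/loc_frac_eq; rewrite /loc_num /loc_den /loc_frac -surjective_pairing.
by rewrite reprK.
Qed.

Definition loc_add (x y : loc) : loc :=
  loc_frac (den (loc_den y) * loc_num x + den (loc_den x) * loc_num y)
    (denM (loc_den x) (loc_den y)).
Definition loc_opp (x : loc) : loc := loc_frac (- loc_num x) (loc_den x).
Definition loc_mul (x y : loc) : loc :=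
  loc_frac (loc_num x * loc_num y) (denM (loc_den x) (loc_den y)).

Lemma loc_addE a s b t : loc_add (loc_frac a s) (loc_frac b t) =
  loc_frac (den t * a + den s * b) (denM s t).
Proof.
apply/loc_frac_eq; rewrite !denME.
have [u Su] := loc_numP a s; have [v Sv] := loc_numP b t.
set a' := loc_num (loc_frac a s); set s' := den (loc_den (loc_frac a s)).
set b' := loc_num (loc_frac b t); set t' := den (loc_den (loc_frac b t)).
move=> f e.
exists (u * v); first exact: mulsetM.
have -> : u * v * (den s * den t * (t' * a' + s' * b')) =
  v * den t * t' * (u * (den s * a')) + u * den s * s' * (v * (den t * b'))
  by ring.
by rewrite -e -f; ring.
Qed.

Lemma loc_oppE a s : loc_opp (loc_frac a s) = loc_frac (- a) s.
Proof.
apply/loc_frac_eq => /=; have [u Su e] := loc_numP a s.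
by exists u => //; rewrite !mulrN e.
Qed.

Lemma loc_mulE a s b t :
  loc_mul (loc_frac a s) (loc_frac b t) = loc_frac (a * b) (denM s t).
Proof.
apply/loc_frac_eq; rewrite !denME.
have [u Su] := loc_numP a s; have [v Sv] := loc_numP b t.
set a' := loc_num (loc_frac a s); set s' := den (loc_den (loc_frac a s)).
set b' := loc_num (loc_frac b t); set t' := den (loc_den (loc_frac b t)).
move=> f e.
exists (u * v); first exact: mulsetM.
have -> : u * v * (den s * den t * (a' * b')) =
  (u * (den s * a')) * (v * (den t * b')) by ring.
by rewrite -e -f; ring.
Qed.

Lemma loc_frac_eq1 a s b t :
  den t * a = den s * b -> loc_frac a s = loc_frac b t.
Proof.
by move=> e; apply/loc_frac_eq; exists 1; [exact: mulset1 | rewrite e].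
Qed.

Lemma loc_addA : associative loc_add.
Proof.
move=> x y z; have [a [s ->]] := loc_fracP x; have [b [t ->]] := loc_fracP y.
have [c [r ->]] := loc_fracP z; rewrite !loc_addE.
by apply: loc_frac_eq1; rewrite ?denME ?den1E; ring.
Qed.

Lemma loc_addC : commutative loc_add.
Proof.
move=> x y; have [a [s ->]] := loc_fracP x; have [b [t ->]] := loc_fracP y.
rewrite !loc_addE.
by apply: loc_frac_eq1; rewrite ?denME ?den1E; ring.
Qed.

Lemma loc_add0 : left_id (loc_frac 0 den1) loc_add.
Proof.
move=> x; have [a [s ->]] := loc_fracP x.
rewrite !loc_addE.
by apply: loc_frac_eq1; rewrite ?denME ?den1E; ring.
Qed.

Lemma loc_addN : left_inverse (loc_frac 0 den1) loc_opp loc_add.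
Proof.
move=> x; have [a [s ->]] := loc_fracP x.
rewrite loc_oppE loc_addE.
by apply: loc_frac_eq1; rewrite ?denME ?den1E; ring.
Qed.

HB.instance Definition _ :=
  GRing.isZmodule.Build loc loc_addA loc_addC loc_add0 loc_addN.

Lemma loc_mulA : associative loc_mul.
Proof.
move=> x y z; have [a [s ->]] := loc_fracP x; have [b [t ->]] := loc_fracP y.
have [c [r ->]] := loc_fracP z; rewrite !loc_mulE.
by apply: loc_frac_eq1; rewrite ?denME ?den1E; ring.
Qed.

Lemma loc_mulC : commutative loc_mul.
Proof.
move=> x y; have [a [s ->]] := loc_fracP x; have [b [t ->]] := loc_fracP y.
rewrite !loc_mulE.
by apply: loc_frac_eq1; rewrite ?denME ?den1E; ring.
Qed.

Lemma loc_mul1 : left_id (loc_frac 1 den1) loc_mul.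
Proof.
move=> x; have [a [s ->]] := loc_fracP x.
rewrite !loc_mulE.
by apply: loc_frac_eq1; rewrite ?denME ?den1E; ring.
Qed.

Lemma loc_mulDl : left_distributive loc_mul loc_add.
Proof.
move=> x y z; have [a [s ->]] := loc_fracP x; have [b [t ->]] := loc_fracP y.
have [c [r ->]] := loc_fracP z.
rewrite loc_addE !loc_mulE loc_addE.
by apply: loc_frac_eq1; rewrite ?denME ?den1E; ring.
Qed.

HB.instance Definition _ :=
  GRing.Zmodule_isComPzRing.Build loc loc_mulA loc_mulC loc_mul1 loc_mulDl.

Definition loc_map (a : R) : loc := loc_frac a den1.

Lemma loc_map_is_zmod_morphism : zmod_morphism loc_map.
Proof.
move=> a b; rewrite /loc_map -[RHS]/(loc_add _ (loc_opp _)).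
by rewrite loc_oppE loc_addE; apply: loc_frac_eq1; rewrite ?denME ?den1E; ring.
Qed.

HB.instance Definition _ :=
  GRing.isZmodMorphism.Build R loc loc_map loc_map_is_zmod_morphism.

Lemma loc_map_is_monoid_morphism : monoid_morphism loc_map.
Proof.
split=> // a b; rewrite /loc_map -[RHS]/(loc_mul _ _) loc_mulE.
by apply: loc_frac_eq1; rewrite ?denME ?den1E; ring.
Qed.

HB.instance Definition _ :=
  GRing.isMonoidMorphism.Build R loc loc_map loc_map_is_monoid_morphism.

Lemma loc_map_unit s : loc_frac 1 s * loc_map (den s) = 1.
Proof.
rewrite -[LHS]/(loc_mul _ _) loc_mulE -[RHS]/(loc_frac 1 den1).
by apply: loc_frac_eq1; rewrite ?denME ?den1E; ring.
Qed.

Lemma loc_fracE a s : loc_frac a s = loc_frac 1 s * loc_map a.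
Proof.
rewrite -[RHS]/(loc_mul _ _) loc_mulE.
by apply: loc_frac_eq1; rewrite ?denME ?den1E; ring.
Qed.

(* S^-1 I; for an ideal I, it is the ideal of S^-1 R generated by the image
   of I, by the next two lemmas. *)
Definition loc_ideal (I : set R) : set loc :=
  [set x | exists a s, I a /\ x = loc_frac a s].

Lemma loc_ideal_is_ideal (I : set R) : is_ideal I -> is_ideal (loc_ideal I).
Proof.
move=> [I0 ID IM]; split.
- by exists 0, den1.
- move=> _ _ [a [s [Ia ->]]] [b [t [Ib ->]]].
  exists (den t * a + den s * b), (denM s t); split.
    by apply: ID; exact: IM.
  by rewrite -[LHS]/(loc_add _ _) loc_addE.
- move=> x _ [a [s [Ia ->]]]; have [b [t ->]] := loc_fracP x.
  exists (b * a), (denM t s); split; first exact: IM.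
  by rewrite -[LHS]/(loc_mul _ _) loc_mulE.
Qed.

Lemma loc_ideal_min (I : set R) (J : set loc) :
  is_ideal J -> loc_map @` I `<=` J -> loc_ideal I `<=` J.
Proof.
move=> [_ _ JM] IJ _ [a [s [Ia ->]]]; rewrite loc_fracE.
by apply/JM/IJ; exists a.
Qed.

End Localization.

Arguments loc_map {R} S a.
Arguments loc_ideal {R} S I _.

Definition S_closure (R : comPzRingType) (S : mulset R) (I : set R) : set R :=
  loc_map S @^-1` loc_ideal S I.

Lemma S_closureP (R : comPzRingType) (S : mulset R) (I : set R) :
  is_ideal I -> S_closure S I = [set a | exists2 s, mulset_set S s & I (s * a)].
Proof.
move=> [_ _ IM]; apply/seteqP; split=> a /=.
  move=> [b [t [Ib /loc_frac_eq[u Su /= e]]]].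
  exists (u * den t).
    by apply: mulsetM => //; exact: denP.
  by rewrite -mulrA e mul1r; exact: IM.
move=> [s Ss Isa]; exists (s * a), (SigSub (mem_set Ss)); split=> //.
by apply/loc_frac_eq; exists 1; [exact: mulset1 | rewrite /= !mul1r].
Qed.

(* dec is the given test deciding whether Q meets S. *)
Definition tildeQ (R : comPzRingType) (S Q : set R)
    (dec : decidable (Q `&` S = set0)) : set R :=
  if dec then Q else [set: R].

(* Main.v *)
Require Import Defs.
From mathcomp Require Import all_boot all_algebra.
From mathcomp Require Import all_classical.

(** Taking the S-closure commutes with finite intersections of ideals: the
    product of finitely many denominators, one for each ideal, is a common
    denominator ([S_closure_bigcap]). It remains to compute the closure of a
    single primary ideal Q, for which there are only two cases. If Q meets S,
    an element of the intersection multiplies the whole ring into Q, so the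
    closure is the ring ([S_closure_meet]). If Q is disjoint from S and
    contains s * a with s in S, then no power of s lies in Q, as S contains all
    of them, so primariness gives a in Q ([S_closure_primary]). *)

Import GRing.Theory.
Local Open Scope ring_scope.
Local Open Scope classical_set_scope.

Lemma mulset_prod (R : comPzRingType) (S : mulset R) (J : finType)
    (s : J -> R) : (forall j, mulset_set S (s j)) -> mulset_set S (\prod_j s j).
Proof.
by move=> Ss; apply: big_ind => // [|x y]; [exact: mulset1 | exact: mulsetM].
Qed.

Lemma mulset_exp (R : comPzRingType) (S : mulset R) (s : R) (n : nat) :
  mulset_set S s -> mulset_set S (s ^+ n).
Proof.
move=> Ss; elim: n => [|n IHn]; first by rewrite expr0; exact: mulset1.
by rewrite exprS; exact: mulsetM.
Qed.

Lemma bigcap_is_ideal {R : comPzRingType} {J : Type} {Q : J -> set R} :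
  (forall j, is_ideal (Q j)) -> is_ideal (\bigcap_j Q j).
Proof.
move=> idQ; split.
- by move=> j _; have [] := idQ j.
- move=> a b Qa Qb j _; have [_ QD _] := idQ j.
  by apply: QD; [exact: Qa | exact: Qb].
- by move=> r a Qa j _; have [_ _ QM] := idQ j; apply: QM; exact: Qa.
Qed.

(** Finiteness matters for the inclusion from right to left: it lets one
    multiply the denominators that clear a into the separate ideals. *)
Lemma S_closure_bigcap (R : comPzRingType) (S : mulset R) (J : finType)
    (Q : J -> set R) :
  (forall j, is_ideal (Q j)) ->
  S_closure S (\bigcap_j Q j) = \bigcap_j S_closure S (Q j).
Proof.
move=> idQ; rewrite (S_closureP S (bigcap_is_ideal idQ)).
apply/seteqP; split=> a /=.
  move=> [s Ss Qsa] j _; rewrite (S_closureP S (idQ j)).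
  by exists s => //; exact: Qsa.
move=> Qa.
have /choice[s sP] j : exists t, mulset_set S t /\ Q j (t * a).
  by have := Qa j I; rewrite (S_closureP S (idQ j)) => -[t St Qta]; exists t.
exists (\prod_j s j); first by apply: mulset_prod => j; case: (sP j).
move=> j _; rewrite (bigD1 j) //= mulrAC mulrC.
by have [_ _ QM] := idQ j; apply: QM; case: (sP j).
Qed.

Lemma S_closure_meet (R : comPzRingType) (S : mulset R) (Q : set R) :
  is_ideal Q -> Q `&` S !=set0 -> S_closure S Q = [set: R].
Proof.
move=> idQ [s [Qs Ss]]; rewrite (S_closureP S idQ) -subTset => a _.
by exists s => //; rewrite mulrC; case: idQ => _ _; exact.
Qed.

(** Primariness is applied to the product a * s: the alternative to a in Q is
    that a power of s lies in both Q and S. *)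
Lemma S_closure_primary (R : comPzRingType) (S : mulset R) (Q : set R) :
  is_primary Q -> Q `&` S = set0 -> S_closure S Q = Q.
Proof.
move=> [idQ _ primQ] QS0; rewrite (S_closureP S idQ).
apply/seteqP; split=> [a /= [s Ss]|a Qa /=].
  rewrite mulrC => /primQ[//|[n Qsn]].
  have : (Q `&` S) (s ^+ n.+1) by split=> //; exact: mulset_exp.
  by rewrite QS0.
by exists 1; [exact: mulset1 | rewrite mul1r].
Qed.

Lemma S_closure_tildeQ (R : comPzRingType) (S : mulset R) (Q : set R)
    (dec : decidable (Q `&` S = set0)) :
  is_primary Q -> S_closure S Q = tildeQ dec.
Proof.
move=> primQ; rewrite /tildeQ; case: dec => [QS0|QS] /=.
  exact: S_closure_primary.
by apply: S_closure_meet; [case: primQ | exact/set0P/eqP].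
Qed.

Local Close Scope classical_set_scope.
Local Close Scope ring_scope.

Theorem mainTheorem7 (R : comPzRingType) (S : mulset R) (n : nat)
    (I : set R) (Q : 'I_n -> set R)
    (idealI : is_ideal I)
    (decompI : primary_decomposition I Q)
    (dec : forall i : 'I_n, decidable (Q i `&` S = set0)%classic) :
  (S_closure S I = \bigcap_(i : 'I_n) tildeQ (dec i))%classic.
Proof.
case: decompI => primQ ->; rewrite S_closure_bigcap; last first.
  by move=> i; case: (primQ i).
by apply: eq_bigcapr => i _; exact: S_closure_tildeQ.
Qed.
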